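(* Given $h\in\mathrm{End}(\mathfrak h\otimes\mathfrak h)$ and $n\ge1$, write $A(\mathcal T_n)=\otimes^{2^n}\mathfrak h$ and let $\iota_{\mathcal T_n}^{\mathcal T_{n+1}}=Y^{\otimes 2^n}:A(\mathcal T_n)\to A(\mathcal T_{n+1})$. Then for $\xi,\eta\in A(\mathcal T_n)$, $$\big\langle\mathfrak H_h\big(\iota_{\mathcal T_n}^{\mathcal T_{n+1}}(\xi)\big),\iota_{\mathcal T_n}^{\mathcal T_{n+1}}(\eta)\big\rangle=\big\langle\mathfrak H_{\mathcal S(h)}\xi,\eta\big\rangle,$$ so that $\langle\mathfrak H_h\xi,\eta\rangle$ on $\otimes^{2^n}\mathfrak h$ extends to a sesquilinear form on $\mathcal H$ provided $\mathcal S^{-k}(\{h\})\neq\emptyset$ for all $k$.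
   Context: $\mathfrak h$ is a finite dimensional complex Hilbert space and $Y:\mathfrak h\to\mathfrak h\otimes\mathfrak h$ is a linear isometry ($Y^*Y=\mathrm{id}$). $\mathcal T_n$ is the planar binary rooted tree with $2^n$ leaves all at the same distance $n$ from the root. $\mathcal H$ is the direct limit pre-Hilbert space of the spaces $A(\mathcal T_n)=\otimes^{2^n}\mathfrak h$ under the isometric embeddings $Y^{\otimes2^n}$. For $h\in\mathrm{End}(\mathfrak h\otimes\mathfrak h)$, $\mathfrak H_h$ denotes the spatially homogeneous nearest neighbour Hamiltonian on $\otimes^N\mathfrak h$ with periodic boundary conditions (for any $N\ge2$; the notation does not record $N$): $\mathfrak H_h=\sum_{i=1}^{N}h_{i,i+1}$, where $h_{i,i+1}$ acts as $h$ on the $i$-th and $(i+1)$-st tensor factors (in that order, indices mod $N$) and as the identity on the others. The scale invariance map $\mathcal S:\mathrm{End}(\mathfrak h\otimes\mathfrak h)\to\mathrm{End}(\mathfrak h\otimes\mathfrak h)$ is the linear map $$\mathcal S(h)=(Y^*\otimes Y^* )(\mathrm{id}\otimes h\otimes\mathrm{id})(Y\otimes Y)+(Y^*hY)\otimes\mathrm{id}.$$ *)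

(* Defs.v *)
From HB Require Import structures.
From mathcomp Require Import all_boot all_order all_algebra.
From mathcomp Require Export complex reals.

Set Implicit Arguments.
Unset Strict Implicit.
Unset Printing Implicit Defensive.

Import Order.TTheory GRing.Theory Num.Theory Num.Def.
Local Open Scope ring_scope.

Section TensorPowers.
Variables (C : numClosedFieldType) (V : vectType C).

Definition bv (a : 'I_(\dim {:V})) : V := (vbasis {:V})`_a.
Definition bcoord (a : 'I_(\dim {:V})) (v : V) : C := coord (vbasis {:V}) a v.

(* A word I = (I_0, ..., I_{N-1}) indexes the vector
   bv I_0 (x) ... (x) bv I_{N-1} of the N-th tensor power of V. *)
Definition word (N : nat) := {ffun 'I_N -> 'I_(\dim {:V})}.

(* The N-th tensor power of V; F represents the tensor
   \sum_I F I *: (bv I_0 (x) ... (x) bv I_{N-1}). *)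
Definition tpow (N : nat) := {ffun word N -> C^o}.
HB.instance Definition _ N := Vector.on (tpow N).

Definition pure N (v : 'I_N -> V) : tpow N :=
  [ffun I : word N => \prod_(k < N) bcoord (I k) (v k)].

Definition tbasis N (I : word N) : tpow N := [ffun J : word N => (J == I)%:R].

(* The basis bv is not assumed orthonormal, hence the Gram factors. *)
Definition tdot (dot : {dot V for conjC}) N (F G : tpow N) : C :=
  \sum_(I : word N) \sum_(J : word N)
    F I * (G J)^* * \prod_(k < N) dot (bv (I k)) (bv (J k)).

Definition word2 a b : word 2 := [ffun k : 'I_2 => if k == ord0 then a else b].

Definition upd N (I : word N) (i : 'I_N) a : word N :=
  [ffun k => if k == i then a else I k].

Definition site_fun (g : 'End(V)) N (i : 'I_N) (F : tpow N) : tpow N :=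
  [ffun I : word N => bcoord (I i) (g (\sum_a F (upd I i a) *: bv a))].

(* The two tensor factors i and j of F, the other letters being frozen as in I;
   only meaningful for i != j. *)
Definition slice N (I : word N) (i j : 'I_N) (F : tpow N) : tpow 2 :=
  [ffun K : word 2 => F (upd (upd I i (K ord0)) j (K ord_max))].

Definition pair_fun (h : 'End(tpow 2)) N (i j : 'I_N) (F : tpow N) : tpow N :=
  [ffun I : word N => h (slice I i j F) (word2 (I i) (I j))].

Lemma leg_subproof N M (e : M = (2 * N)%N) (i : 'I_N) (b : 'I_2) :
  (2 * i + b < M)%N.
Proof.
rewrite e; apply: (@leq_trans (2 * i.+1)); last by rewrite leq_mul2l ltn_ord.
by rewrite mulnS addnC ltn_add2r.
Qed.

(* The factors 2 i and 2 i + 1 of the 2N-th tensor power are the outputs of the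
   copy of Y acting on the factor i. *)
Definition leg N M (e : M = (2 * N)%N) (i : 'I_N) (b : 'I_2) : 'I_M :=
  Ordinal (leg_subproof e i b).

Definition block N M (e : M = (2 * N)%N) (I : word M) (i : 'I_N) : word 2 :=
  [ffun b : 'I_2 => I (leg e i b)].

Definition Ypow_fun (Y : 'Hom(V, tpow 2)) N M (e : M = (2 * N)%N)
    (F : tpow N) : tpow M :=
  [ffun I : word M =>
     \sum_(J : word N) F J * \prod_(i < N) Y (bv (J i)) (block e I i)].

(* Ys stands for the adjoint of Y, as the theorem assumes. *)
Definition Ystarpow_fun (Ys : 'Hom(tpow 2, V)) N M (e : M = (2 * N)%N)
    (G : tpow M) : tpow N :=
  [ffun J : word N =>
     \sum_(I : word M) G I *
       \prod_(i < N) bcoord (J i) (Ys (tbasis (block e I i)))].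

Fact site_linear g N i : linear (@site_fun g N i).
Proof.
move=> a F G; apply/ffunP => I; rewrite !ffunE -linearP /=; congr bcoord.
rewrite -linearP; congr (g _); rewrite scaler_sumr -big_split /=.
by apply: eq_bigr => k _; rewrite !ffunE scalerDl scalerA.
Qed.
HB.instance Definition _ g N i :=
  GRing.isLinear.Build C (tpow N) (tpow N) *:%R (@site_fun g N i)
    (@site_linear g N i).

Fact slice_linear N I i j : linear (@slice N I i j).
Proof. by move=> a F G; apply/ffunP => K; rewrite !ffunE. Qed.
HB.instance Definition _ N I i j :=
  GRing.isLinear.Build C (tpow N) (tpow 2) *:%R (@slice N I i j)
    (@slice_linear N I i j).

Fact pair_linear h N i j : linear (@pair_fun h N i j).
Proof. by move=> a F G; apply/ffunP => I; rewrite !ffunE !linearP !ffunE. Qed.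
HB.instance Definition _ h N i j :=
  GRing.isLinear.Build C (tpow N) (tpow N) *:%R (@pair_fun h N i j)
    (@pair_linear h N i j).

Fact Ypow_linear Y N M e : linear (@Ypow_fun Y N M e).
Proof.
move=> a F G; apply/ffunP => I; rewrite !ffunE scaler_sumr -big_split /=.
by apply: eq_bigr => J _; rewrite !ffunE mulrDl scalerAl.
Qed.
HB.instance Definition _ Y N M e :=
  GRing.isLinear.Build C (tpow N) (tpow M) *:%R (@Ypow_fun Y N M e)
    (@Ypow_linear Y N M e).

Fact Ystarpow_linear Ys N M e : linear (@Ystarpow_fun Ys N M e).
Proof.
move=> a F G; apply/ffunP => J; rewrite !ffunE scaler_sumr -big_split /=.
by apply: eq_bigr => I _; rewrite !ffunE mulrDl scalerAl.
Qed.
HB.instance Definition _ Ys N M e :=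
  GRing.isLinear.Build C (tpow M) (tpow N) *:%R (@Ystarpow_fun Ys N M e)
    (@Ystarpow_linear Ys N M e).

Definition site_op (g : 'End(V)) N (i : 'I_N) : 'End(tpow N) :=
  linfun (site_fun g i).
Definition pair_op (h : 'End(tpow 2)) N (i j : 'I_N) : 'End(tpow N) :=
  linfun (pair_fun h i j).
Definition Ypow (Y : 'Hom(V, tpow 2)) N M (e : M = (2 * N)%N) :
  'Hom(tpow N, tpow M) := linfun (Ypow_fun Y e).
Definition Ystarpow (Ys : 'Hom(tpow 2, V)) N M (e : M = (2 * N)%N) :
  'Hom(tpow M, tpow N) := linfun (Ystarpow_fun Ys e).

(* These facts pin down the encodings on pure tensors. *)
Lemma bvE (v : V) : v = \sum_a bcoord a v *: bv a.
Proof. exact: (coord_vbasis (memvf v)). Qed.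

Lemma bcoord_bv a b : bcoord a (bv b : V) = (b == a)%:R.
Proof. by have := coord_free b a (basis_free (vbasisP {:V})); rewrite /bcoord /bv => ->; rewrite eq_sym. Qed.

Lemma tdot_pure (dot : {dot V for conjC}) N (v w : 'I_N -> V) :
  tdot dot (pure v) (pure w) = \prod_(k < N) dot (v k) (w k).
Proof.
transitivity (\prod_(k < N) \sum_a \sum_b bcoord a (v k) * (bcoord b (w k))^* * dot (bv a) (bv b)).
  rewrite (bigA_distr_bigA (fun k a => \sum_b bcoord a (v k) * (bcoord b (w k))^* * dot (bv a) (bv b))).
  apply: eq_bigr => I _.
  rewrite (bigA_distr_bigA (fun k b => bcoord (I k) (v k) * (bcoord b (w k))^* * dot (bv (I k)) (bv b))).
  by apply: eq_bigr => J _; rewrite !ffunE rmorph_prod !big_split.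
apply: eq_bigr => k _; rewrite [in RHS](bvE (v k)) [in RHS](bvE (w k)).
rewrite linear_sumlz; apply: eq_bigr => a _; rewrite linear_sumr; apply: eq_bigr => b _.
by rewrite linearZl_LR linearZr_LR /= mulrA.
Qed.

Lemma bcoordZ a c (v : V) : bcoord a (c *: v) = c * bcoord a v.
Proof. exact: linearZ. Qed.

Lemma site_pure (g : 'End(V)) N (i : 'I_N) (v : 'I_N -> V) :
  site_op g i (pure v) = pure (fun k => if k == i then g (v k) else v k).
Proof.
rewrite lfunE; apply/ffunP => I; rewrite !ffunE.
transitivity (bcoord (I i) (g ((\prod_(k < N | k != i) bcoord (I k) (v k)) *: v i))).
  congr bcoord; congr (g _); rewrite [X in _ = _ *: X](bvE (v i)) scaler_sumr.
  apply: eq_bigr => a _; rewrite !ffunE scalerA; congr (_ *: _).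
  rewrite (bigD1 i) //= !ffunE eqxx mulrC; congr (_ * _).
  by apply: eq_bigr => k /negPf ki; rewrite !ffunE ki.
rewrite linearZ /= bcoordZ [RHS](bigD1 i) //= eqxx mulrC; congr (_ * _).
by apply: eq_bigr => k /negPf ->.
Qed.

Lemma pair_pure (h : 'End(tpow 2)) (a b : 'End(V)) N (i j : 'I_N) (v : 'I_N -> V) :
  i != j ->
  (forall x : 'I_2 -> V, h (pure x) = pure (fun k => if k == ord0 then a (x k) else b (x k))) ->
  pair_op h i j (pure v) =
   pure (fun k => if k == i then a (v k) else if k == j then b (v k) else v k).
Proof.
move=> ij hE; rewrite lfunE; apply/ffunP => I; rewrite !ffunE.
have -> : slice I i j (pure v) = (\prod_(k < N | (k != i) && (k != j)) bcoord (I k) (v k)) *: pure (fun k : 'I_2 => if k == ord0 then v i else v j).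
  apply/ffunP => K; rewrite !ffunE (bigD1 i) //= (bigD1 j) 1?eq_sym //= !ffunE eqxx (negPf ij) eqxx.
  rewrite big_ord_recl big_ord1 /= mulrA mulrC [RHS]mulrC -[RHS]mulrC; congr (_ * _).
    by apply: eq_bigr => k /andP[/negPf ki /negPf kj]; rewrite !ffunE ki kj.
  by congr (bcoord (K _) _ * bcoord (K _) _); apply/val_inj.
rewrite linearZ /= hE !ffunE big_ord_recl big_ord1 /= !ffunE /=.
rewrite [RHS](bigD1 i) //= [X in _ = _ * X](bigD1 j) 1?eq_sym //= !eqxx [j == i]eq_sym (negPf ij).
rewrite [RHS]mulrA [RHS]mulrC; congr (_ * _).
by apply: eq_bigr => k /andP[/negPf -> /negPf ->].
Qed.

Lemma Ypow_pure (Y : 'Hom(V, tpow 2)) N M e (v : 'I_N -> V) (I : word M) :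
  Ypow Y e (pure v) I = \prod_(i < N) Y (v i) (block e I i).
Proof.
rewrite lfunE !ffunE.
transitivity (\prod_(i < N) \sum_a bcoord a (v i) * Y (bv a) (block e I i)).
  rewrite (bigA_distr_bigA (fun i a => bcoord a (v i) * Y (bv a) (block e I i))).
  by apply: eq_bigr => J _; rewrite !ffunE big_split.
apply: eq_bigr => i _; rewrite [in RHS](bvE (v i)) linear_sum sum_ffunE.
by apply: eq_bigr => a _; rewrite linearZ !ffunE.
Qed.

(* ordS is the cyclic successor, so that the boundary conditions are periodic.
   Only meaningful for N >= 2. *)
Definition hamiltonian (h : 'End(tpow 2)) (N : nat) : 'End(tpow N) :=
  \sum_(i < N) pair_op h i (ordS i).

Definition scaleS (Y : 'Hom(V, tpow 2)) (Ys : 'Hom(tpow 2, V))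
    (h : 'End(tpow 2)) : 'End(tpow 2) :=
  let e : 4%N = (2 * 2)%N := erefl in
  (Ystarpow Ys e \o
    (pair_op h (@Ordinal 4 1 isT) (@Ordinal 4 2 isT) \o Ypow Y e))%VF
  + site_op (Ys \o (h \o Y))%VF (ord0 : 'I_2).

Definition embed (Y : 'Hom(V, tpow 2)) (n : nat) :
  'Hom(tpow (2 ^ n), tpow (2 ^ n.+1)) := Ypow Y (expnS 2 n).

(* (H, j) is a realization of the direct limit of the pre-Hilbert spaces
   tpow (2 ^ n) along the maps embed Y n: as the j n are isometric, hence
   injective, each element of H is the class of some (n, xi), and (n, xi),
   (m, eta) define the same element iff they agree in some tpow (2 ^ k),
   k >= n, m. *)
Record direct_limit (dot : {dot V for conjC}) (Y : 'Hom(V, tpow 2))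
    (H : lmodType C) (dotH : {dot H for conjC})
    (j : forall n, {linear tpow (2 ^ n) -> H}) : Prop := DirectLimit {
  direct_limit_isometry : forall n (xi eta : tpow (2 ^ n)),
    dotH (j n xi) (j n eta) = tdot dot xi eta;
  direct_limit_compat : forall n (xi : tpow (2 ^ n)),
    j n.+1 (embed Y n xi) = j n xi;
  direct_limit_exhaust : forall x : H,
    exists n (xi : tpow (2 ^ n)), j n xi = x
}.

End TensorPowers.

Notation sesquilinear_form H :=
  {bilinear H -> H -> _ | *%R & (conjC \; *%R)}.

(* Main.v *)
Require Import Defs.
From HB Require Import structures.
From mathcomp Require Import all_boot all_order all_algebra.
From mathcomp Require Import boolp.

Set Implicit Arguments.
Unset Strict Implicit.
Unset Printing Implicit Defensive.

Import Order.TTheory GRing.Theory Num.Theory Num.Def.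
Local Open Scope ring_scope.

(** The tensor power with M = 2 N factors is cut into N blocks of two factors,
    the block i being the output of the copy of Y that acts on the factor i.
    The adjoint of Y^(x)N is the N-th tensor power of the adjoint Ys of Y
    ([tdot_Ypow]), so the first claim is the operator identity
    [scaling_hamiltonian],
      (Ys)^(x)N o H_h o Y^(x)N = H_(S h)   on N >= 2 factors.
    Of the 2 N terms of H_h, those with both factors in one block meet only one
    copy of Y, and Ys Y = id removes the others: they give Ys h Y at that site
    ([scaling_inner]).  Those that straddle two consecutive blocks meet two
    copies, and give the first summand of S h on this pair of sites
    ([scaling_outer]).  Pairing the two kinds site by site gives H_(S h).

    For the straddling terms both sides are linear in h, so that h may be taken
    of the form a (x) b ([eq_on_products]).  Such an operator sends products of
    blocks to products of blocks, and everything is computed factor by factor.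

    The second claim needs a coherent sequence h = S h_1, h_1 = S h_2, ..., not
    just one preimage of h under each power of S.  Here finite dimension enters:
    the decreasing images of the powers of S become stationary at some subspace
    U, which S maps onto itself; h lies in U, and preimages can be chosen in U
    forever ([coherent_preimages]).  By the first claim, the forms given by the
    Hamiltonians of h_k on level n + k agree along the embeddings; as each map
    to the limit is injective, they define one form there ([glue_form]). *)

(** * Tensor powers cut into blocks of two factors *)

Section Blocks.
Variables (C : numClosedFieldType) (V : vectType C).
Implicit Types (N M : nat).

Lemma leg_bij N M (e : M = (2 * N)%N) :
  bijective (fun p : 'I_N * 'I_2 => leg e p.1 p.2).
Proof.
apply: inj_card_bij => [[i b] [i' b'] /(congr1 val) /= E|]; last first.
  by rewrite card_prod !card_ord e mulnC.
have [lb lb'] := (ltn_ord b, ltn_ord b').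
have E2 : b = b'.
  apply/val_inj; move: (congr1 (modn^~ 2%N) E) => /=.
  by rewrite ![(2 * _)%N]mulnC !modnMDl !modn_small.
have E1 : i = i'.
  by apply/val_inj/eqP; rewrite -(eqn_pmul2l (isT : (0 < 2)%N)) -(eqn_add2r b) {2}E2 E.
by rewrite E1 E2.
Qed.

Lemma leg_eq N M (e : M = (2 * N)%N) i i' b b' :
  (leg e i b == leg e i' b') = (i == i') && (b == b').
Proof.
by rewrite -xpair_eqE -(inj_eq (bij_inj (leg_bij e))).
Qed.

Lemma big_leg (T : Type) (idx : T) (op : Monoid.com_law idx) N M
    (e : M = (2 * N)%N) (F : 'I_M -> T) :
  \big[op/idx]_(k < M) F k =
  \big[op/idx]_(i < N) op (F (leg e i ord0)) (F (leg e i ord_max)).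
Proof.
rewrite (reindex _ (onW_bij _ (leg_bij e))) /=.
rewrite -(pair_bigA _ (fun i b => F (leg e i b))) /=.
apply: eq_bigr => i _; rewrite big_ord_recl big_ord1; congr (op _ (F (leg e i _))).
exact/val_inj.
Qed.

Lemma ordS_leg0 N M (e : M = (2 * N)%N) i :
  ordS (leg e i ord0) = leg e i ord_max.
Proof.
subst M; apply/val_inj; rewrite /= addn0 addn1 modn_small //.
have := ltn_ord i; rewrite -(leq_pmul2l (isT : (0 < 2)%N)) mulnS.
by apply: leq_trans; rewrite add2n.
Qed.

Lemma ordS_leg1 N M (e : M = (2 * N)%N) i :
  ordS (leg e i ord_max) = leg e (ordS i) ord0.
Proof.
subst M; apply/val_inj; rewrite /= addn0 addn1 muln_modr.
by congr modn; rewrite mulnS.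
Qed.

Lemma ordS_neq N (i : 'I_N) : (2 <= N)%N -> i != ordS i.
Proof.
move=> N2; apply/eqP => /(congr1 val) /=; have := ltn_ord i.
rewrite leq_eqVlt => /orP[/eqP iN|lt_iN] iE.
  by move: N2; rewrite -iN iE iN modnn.
by have := ltnSn i; rewrite {1}iE modn_small // ltnn.
Qed.

Lemma blocks_bij N M (e : M = (2 * N)%N) :
  bijective (fun I : word V M => [ffun i => block e I i]).
Proof.
apply: inj_card_bij => [I J /ffunP E|]; last first.
  by rewrite !card_ffun !card_ord e expnM.
apply/ffunP => k; have [g _ gK] := leg_bij e.
have := E (g k).1; rewrite !ffunE => /ffunP/(_ (g k).2); rewrite !ffunE.
by have /= -> := gK k.
Qed.

Lemma prod_sum_block N M (e : M = (2 * N)%N) (f : 'I_N -> word V 2 -> C) :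
  \prod_(i < N) \sum_K f i K = \sum_(I : word V M) \prod_(i < N) f i (block e I i).
Proof.
rewrite bigA_distr_bigA (reindex _ (onW_bij _ (blocks_bij e))) /=.
by apply: eq_bigr => I _; apply: eq_bigr => i _; rewrite ffunE.
Qed.

(** The tensor product of one element of the square of V for each block. *)
Definition bprod N M (e : M = (2 * N)%N) (F : 'I_N -> tpow V 2) : tpow V M :=
  [ffun I => \prod_(i < N) F i (block e I i)].

Lemma tpowE N (F : tpow V N) : F = \sum_I F I *: tbasis I.
Proof.
apply/ffunP => J; rewrite sum_ffunE (bigD1 J) //= big1 => [|I /negPf IJ].
  by rewrite !ffunE eqxx addr0 [_ *: _]mulr1.
by rewrite !ffunE eq_sym IJ [_ *: _]mulr0.
Qed.

Lemma tbasis_pure N (I : word V N) : tbasis I = pure (fun k => bv (I k)).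
Proof.
apply/ffunP => J; rewrite !ffunE; case: eqP => [->|JI].
  by rewrite big1 // => k _; rewrite bcoord_bv eqxx.
symmetry; apply/eqP/prodf_eq0.
have /existsP[k JIk] : [exists k, J k != I k].
  apply: contra_notT JI => /existsPn JI; apply/ffunP => k; apply/eqP.
  by have := JI k; rewrite negbK.
by exists k; rewrite // bcoord_bv [I k == _]eq_sym (negPf JIk).
Qed.

Lemma tbasis_bprod N M (e : M = (2 * N)%N) (I : word V M) :
  tbasis I = bprod e (fun i => tbasis (block e I i)).
Proof.
rewrite tbasis_pure; apply/ffunP => J.
transitivity (\prod_(i < N) (pure (fun k => bv (block e I i k)) : tpow V 2) (block e J i)).
  rewrite ffunE (big_leg _ e); apply: eq_bigr => i _.
  rewrite ffunE big_ord_recl big_ord1 !ffunE.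
  by congr (_ * bcoord (J (leg e i _)) (bv (I (leg e i _)))); apply/val_inj.
by rewrite !ffunE; apply: eq_bigr => i _; rewrite tbasis_pure.
Qed.

(** Pure tensors of basis vectors span. *)
Lemma eq_on_pure (W : lmodType C) N (f g : {linear tpow V N -> W}) :
  (forall v, f (pure v) = g (pure v)) -> f =1 g.
Proof.
move=> E F; rewrite (tpowE F) !linear_sum; apply: eq_bigr => I _.
by rewrite !linearZ tbasis_pure E.
Qed.

Lemma Ypow_pure_bprod (Y : 'Hom(V, tpow V 2)) N M (e : M = (2 * N)%N) v :
  Ypow Y e (pure v) = bprod e (fun i => Y (v i)).
Proof. by apply/ffunP => I; rewrite Ypow_pure ffunE. Qed.

Lemma bcoord_sum I r (P : pred I) a (E : I -> V) :
  bcoord a (\sum_(i <- r | P i) E i) = \sum_(i <- r | P i) bcoord a (E i).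
Proof. exact: linear_sum. Qed.

Lemma Ystarpow_bprod (Ys : 'Hom(tpow V 2, V)) N M (e : M = (2 * N)%N) F :
  Ystarpow Ys e (bprod e F) = pure (fun i => Ys (F i)).
Proof.
rewrite lfunE; apply/ffunP => J; rewrite !ffunE.
transitivity (\prod_(i < N) \sum_K F i K * bcoord (J i) (Ys (tbasis K))).
  rewrite (prod_sum_block e (fun i K => F i K * bcoord (J i) (Ys (tbasis K)))).
  by apply: eq_bigr => I _; rewrite !ffunE -big_split.
apply: eq_bigr => i _; rewrite [in RHS](tpowE (F i)) linear_sum bcoord_sum.
by apply: eq_bigr => K _; rewrite linearZ /= bcoordZ.
Qed.

Lemma block_upd N M (e : M = (2 * N)%N) (I : word V M) i b c k :
  block e (upd I (leg e i b) c) k =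
  if k == i then upd (block e I i) b c else block e I k.
Proof.
case: eqP => [->|/eqP/negPf ki]; apply/ffunP => b'; rewrite !ffunE leg_eq ?ki //.
by rewrite eqxx.
Qed.

(** * One- and two-site operators on products of blocks *)

Lemma site_bprod (g : 'End(V)) N M (e : M = (2 * N)%N) i b F :
  site_op g (leg e i b) (bprod e F) =
  bprod e (fun k => if k == i then site_op g b (F k) else F k).
Proof.
rewrite lfunE; apply/ffunP => I; rewrite !ffunE [RHS](bigD1 i) //= eqxx.
rewrite lfunE ffunE ffunE mulrC.
under [X in _ = X * _]eq_bigr => k /negPf ki do rewrite ki.
rewrite -bcoordZ -linearZ; congr (bcoord _ (g _)); rewrite scaler_sumr.
apply: eq_bigr => c _; rewrite scalerA !ffunE (bigD1 i) //= mulrC.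
rewrite block_upd eqxx; congr (_ * _ *: _); apply: eq_bigr => k /negPf ki.
by rewrite block_upd ki.
Qed.

Lemma pair_bprod (h : 'End(tpow V 2)) N M (e : M = (2 * N)%N) i F :
  pair_op h (leg e i ord0) (leg e i ord_max) (bprod e F) =
  bprod e (fun k => if k == i then h (F k) else F k).
Proof.
rewrite lfunE; apply/ffunP => I; rewrite !ffunE [RHS](bigD1 i) //= eqxx.
(* Frozen outside the block i, the product is a multiple of F i. *)
have -> : slice I (leg e i ord0) (leg e i ord_max) (bprod e F) =
    (\prod_(k < N | k != i) F k (block e I k)) *: F i.
  apply/ffunP => K; rewrite !ffunE (bigD1 i) //= [RHS]mulrC.
  congr (_ * _); last first.
    by apply: eq_bigr => k /negPf ki; rewrite !block_upd ki.
  congr (F i _); rewrite !block_upd eqxx; apply/ffunP => b; rewrite !ffunE.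
  case: eqP => [-> //|b1]; case: eqP => [-> //|b0].
  by case: b b0 b1 => [[|[|//]]] lb b0 b1; [case: b0|case: b1]; apply/val_inj.
rewrite linearZ /= ffunE mulrC; congr (_ * _).
  by apply: eq_bigr => k /negPf ->.
congr (h _ _); apply/ffunP => b; rewrite !ffunE.
case: eqP => [-> //|b0]; congr (I (leg e i _)).
by case: b b0 => [[|[|//]]] lb b0; [case: b0|]; apply/val_inj.
Qed.

(** h = a (x) b, tested on pure tensors. *)
Definition is_product (h : 'End(tpow V 2)) (a b : 'End(V)) : Prop :=
  forall x : 'I_2 -> V,
    h (pure x) = pure (fun k => if k == ord0 then a (x k) else b (x k)).

Lemma pair_site (h : 'End(tpow V 2)) (a b : 'End(V)) N (i j : 'I_N) F :
  i != j -> is_product h a b ->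
  pair_op h i j F = site_op a i (site_op b j F).
Proof.
move=> ij hE; rewrite -[RHS]comp_lfunE; move: F.
apply/eq_on_pure => v /=; rewrite (pair_pure _ ij hE) comp_lfunE !site_pure.
by congr pure; apply/funext => k; case: eqP => // ->; rewrite (negPf ij).
Qed.

Lemma pair_site0 (g : 'End(V)) N (i j : 'I_N) :
  i != j -> pair_op (site_op g (ord0 : 'I_2)) i j = site_op g i.
Proof.
move=> ij; apply/lfunP/eq_on_pure => v /=; rewrite (@pair_pure _ _ _ g \1%VF) //=.
  by rewrite site_pure; congr pure; apply/funext => k; rewrite id_lfunE if_same.
by move=> x; rewrite site_pure; congr pure; apply/funext => k; rewrite id_lfunE.
Qed.

(** Matrix units of the square of V; they are products of matrix units of V and
    span the operators there. *)
Definition munit_fun (K L : word V 2) (F : tpow V 2) : tpow V 2 :=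
  F K *: tbasis L.
Fact munit_linear K L : linear (munit_fun K L).
Proof. by move=> a F G; rewrite /munit_fun !ffunE scalerDl scalerA. Qed.
HB.instance Definition _ K L :=
  GRing.isLinear.Build C (tpow V 2) (tpow V 2) *:%R (munit_fun K L)
    (munit_linear K L).
Definition munit K L : 'End(tpow V 2) := linfun (munit_fun K L).

Definition vunit_fun (a b : 'I_(\dim {:V})) (v : V) : V := bcoord a v *: bv b.
Fact vunit_linear a b : linear (vunit_fun a b).
Proof. by move=> c v w; rewrite /vunit_fun /bcoord linearP scalerDl scalerA. Qed.
HB.instance Definition _ a b :=
  GRing.isLinear.Build C V V *:%R (vunit_fun a b) (vunit_linear a b).
Definition vunit a b : 'End(V) := linfun (vunit_fun a b).

Lemma munit_product K L :
  is_product (munit K L) (vunit (K ord0) (L ord0)) (vunit (K ord_max) (L ord_max)).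
Proof.
move=> x; rewrite lfunE /= /munit_fun tbasis_pure; apply/ffunP => J.
rewrite !ffunE !big_ord_recl !big_ord0 !mulr1 /= !lfunE /= /vunit_fun !bcoordZ.
have -> : lift ord0 ord0 = ord_max :> 'I_2 by exact/val_inj.
by rewrite [_ *: _]mulrACA.
Qed.

Lemma End2E (h : 'End(tpow V 2)) :
  h = \sum_(p : word V 2 * word V 2) h (tbasis p.1) p.2 *: munit p.1 p.2.
Proof.
apply/lfunP => F; rewrite -(pair_bigA _ (fun K L => h (tbasis K) L *: munit K L)) /=.
rewrite {1}(tpowE F) linear_sum sum_lfunE; apply: eq_bigr => K _.
rewrite linearZ /= {1}(tpowE (h (tbasis K))) scaler_sumr sum_lfunE.
apply: eq_bigr => L _; rewrite scale_lfunE lfunE /= /munit_fun !scalerA.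
by rewrite mulrC.
Qed.

Lemma pair_op_linear N (i j : 'I_N) : linear (fun h : 'End(tpow V 2) => pair_op h i j).
Proof.
move=> c h h'; apply/lfunP => F; rewrite add_lfunE scale_lfunE !lfunE /=.
by apply/ffunP => I; rewrite !ffunE add_lfunE scale_lfunE !ffunE.
Qed.

(** The reduction to h = a (x) b: matrix units are products, and span. *)
Lemma eq_on_products (W : lmodType C) (f g : 'End(tpow V 2) -> W) :
  linear f -> linear g ->
  (forall h a b, is_product h a b -> f h = g h) -> f =1 g.
Proof.
move=> flin glin fg h.
pose lf : {linear _ -> _} := HB.pack f (GRing.isLinear.Build _ _ _ _ f flin).
pose lg : {linear _ -> _} := HB.pack g (GRing.isLinear.Build _ _ _ _ g glin).
rewrite -[f]/(lf : _ -> _) -[g]/(lg : _ -> _) (End2E h) !linear_sum.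
apply: eq_bigr => p _; rewrite !linearZ; congr (_ *: _).
exact: fg (munit_product _ _).
Qed.

Lemma sandwich_linear (U W X Z : vectType C) (A : 'Hom(X, Z)) (B : 'Hom(U, W)) :
  linear (fun T : 'Hom(W, X) => (A \o (T \o B))%VF).
Proof.
move=> c S T; apply/lfunP => u.
by rewrite !(comp_lfunE, add_lfunE, scale_lfunE) linearP.
Qed.

(** * The inner product on tensor powers *)

Section Form.
Variable dot : {dot V for conjC}.

Lemma dotC u v : dot u v = (dot v u)^*.
Proof. by rewrite [LHS]hermC expr0 mul1r. Qed.

Lemma tdotC N (F G : tpow V N) : tdot dot F G = (tdot dot G F)^*.
Proof.
rewrite [in RHS]/tdot exchange_big rmorph_sum; apply: eq_bigr => I _.
rewrite rmorph_sum; apply: eq_bigr => J _.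
rewrite !rmorphM /= conjCK rmorph_prod [F I * _]mulrC; congr (_ * _).
by apply: eq_bigr => k _; rewrite dotC.
Qed.

Lemma tdotPl N a (F F' G : tpow V N) :
  tdot dot (a *: F + F') G = a * tdot dot F G + tdot dot F' G.
Proof.
rewrite /tdot mulr_sumr -big_split; apply: eq_bigr => I _ /=.
rewrite mulr_sumr -big_split; apply: eq_bigr => J _ /=.
by rewrite !ffunE !mulrDl !mulrA.
Qed.

Lemma tdotPr N a (F G G' : tpow V N) :
  tdot dot F (a *: G + G') = a^* * tdot dot F G + tdot dot F G'.
Proof. by rewrite tdotC tdotPl rmorphD rmorphM /= -!tdotC. Qed.

Lemma tdot0l N (G : tpow V N) : tdot dot 0 G = 0.
Proof.
by rewrite /tdot big1 // => I _; rewrite big1 // => J _; rewrite !ffunE !mul0r.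
Qed.

Lemma tdot_suml N I r (P : pred I) (E : I -> tpow V N) (G : tpow V N) :
  tdot dot (\sum_(i <- r | P i) E i) G = \sum_(i <- r | P i) tdot dot (E i) G.
Proof.
apply: (big_morph (fun F => tdot dot F G)); last exact: tdot0l.
by move=> F F'; have := tdotPl 1 F F' G; rewrite scale1r mul1r.
Qed.

Lemma tdotZl N a (F G : tpow V N) : tdot dot (a *: F) G = a * tdot dot F G.
Proof. by rewrite -[a *: F]addr0 tdotPl tdot0l addr0. Qed.

(** The Gram matrix of the basis is invertible, since the combination given by a
    vector of its kernel has norm 0. *)
Lemma dual_basis (a : 'I_(\dim {:V})) :
  exists w : V, forall b, dot (bv b) w = (b == a)%:R.
Proof.
pose G := \matrix_(b, c) dot (bv b : V) (bv c).
have Gu : G \in unitmx.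
  rewrite -row_free_unit -kermx_eq0; apply/rowV0P => u /sub_kermxP uG.
  have u0 : \sum_b u 0 b *: bv b = 0 :> V.
    apply/eqP; rewrite -(dnorm_eq0 dot) linear_sumr big1 // => c _.
    rewrite linearZr_LR /= linear_sumlz (_ : \sum_i _ = (u *m G) 0 c).
      by rewrite uG mxE mulr0.
    by rewrite mxE; apply: eq_bigr => b _; rewrite linearZl_LR mxE.
  apply/rowP => a'; rewrite mxE.
  have := congr1 (bcoord a') u0; rewrite bcoord_sum (bigD1 a') //= big1.
    by rewrite addr0 bcoordZ bcoord_bv eqxx mulr1 => ->; apply: linear0.
  by move=> b /negPf ba; rewrite bcoordZ bcoord_bv ba mulr0.
exists (\sum_c (invmx G c a)^* *: bv c) => b.
rewrite linear_sumr -[RHS](_ : (G *m invmx G) b a = _); last by rewrite mulmxV // mxE.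
rewrite mxE; apply: eq_bigr => c _.
by rewrite linearZr_LR /= conjCK mxE mulrC.
Qed.

(** Pure tensors of dual basis vectors read off the coordinates of F. *)
Lemma tdot_nondegenerate N (F : tpow V N) :
  (forall G, tdot dot F G = 0) -> F = 0.
Proof.
move=> F0; have [w wE] := choice dual_basis; apply/ffunP => I; rewrite ffunE.
rewrite -(F0 (pure (fun k => w (I k)))) [in RHS](tpowE F) tdot_suml.
rewrite (bigD1 I) //= big1 => [|J /negPf JI].
  rewrite addr0 tdotZl tbasis_pure tdot_pure big1 ?mulr1 // => k _.
  by rewrite wE eqxx.
rewrite tdotZl tbasis_pure tdot_pure; apply/eqP; rewrite mulf_eq0; apply/orP; right.
apply/eqP; transitivity ((tbasis I : tpow V N) J); last by rewrite ffunE JI.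
rewrite tbasis_pure ffunE; apply: eq_bigr => k _.
by rewrite wE bcoord_bv eq_sym.
Qed.

Lemma tdot_bprod N M (e : M = (2 * N)%N) (F G : 'I_N -> tpow V 2) :
  tdot dot (bprod e F) (bprod e G) = \prod_(i < N) tdot dot (F i) (G i).
Proof.
rewrite /tdot (prod_sum_block e (fun i K => \sum_L F i K * (G i L)^* *
  \prod_(k < 2) dot (bv (K k)) (bv (L k)))); apply: eq_bigr => I _.
rewrite (prod_sum_block e (fun i L => F i (block e I i) * (G i L)^* *
  \prod_(k < 2) dot (bv (block e I i k)) (bv (L k)))); apply: eq_bigr => J _.
rewrite !ffunE rmorph_prod !big_split; congr (_ * _).
rewrite (big_leg _ e); apply: eq_bigr => i _.
rewrite big_ord_recl big_ord1 !ffunE.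
by congr (_ * dot (bv (I (leg e i _))) (bv (J (leg e i _)))); apply/val_inj.
Qed.

End Form.

(** * Compressing the Hamiltonian by Y *)

Section Adjoint.
Variables (dot : {dot V for conjC}) (Y : 'Hom(V, tpow V 2)) (Ys : 'Hom(tpow V 2, V)).
Hypothesis adjY : forall v w, tdot dot (Y v) w = dot v (Ys w).
Hypothesis isoY : (Ys \o Y)%VF = \1%VF.

(** The adjoint of a tensor power of Y is that of Ys: on products of blocks and
    pure tensors both sides factor over the sites. *)
Lemma tdot_Ypow N M (e : M = (2 * N)%N) F G :
  tdot dot F (Ypow Y e G) = tdot dot (Ystarpow Ys e F) G.
Proof.
rewrite (tpowE F) linear_sum !tdot_suml; apply: eq_bigr => I _.
rewrite linearZ /= !tdotZl (tbasis_bprod e) Ystarpow_bprod; congr (_ * _).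
rewrite tdotC [RHS]tdotC (tpowE G) linear_sum !tdot_suml; congr (_^* ).
apply: eq_bigr => J _; rewrite linearZ /= !tdotZl tbasis_pure Ypow_pure_bprod.
rewrite tdot_bprod tdot_pure; congr (_ * _).
by apply: eq_bigr => i _; rewrite adjY.
Qed.

Lemma YsK v : Ys (Y v) = v.
Proof. by have /lfunP/(_ v) := isoY; rewrite comp_lfunE id_lfunE. Qed.

(** The operator meets only the copy of Y at i; the others cancel by Ys Y = id. *)
Lemma scaling_inner h N M (e : M = (2 * N)%N) i :
  (Ystarpow Ys e \o (pair_op h (leg e i ord0) (leg e i ord_max) \o Ypow Y e))%VF
  = site_op (Ys \o (h \o Y))%VF i.
Proof.
apply/lfunP/eq_on_pure => v /=; rewrite !comp_lfunE Ypow_pure_bprod pair_bprod.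
rewrite Ystarpow_bprod site_pure; congr pure; apply/funext => k.
by case: eqP => _; rewrite ?YsK // !comp_lfunE.
Qed.

Definition conj_site (g : 'End(V)) (b : 'I_2) : 'End(V) :=
  (Ys \o (site_op g b \o Y))%VF.

(** a (x) b across a block boundary acts on the right leg of the block i and on the
    left leg of the block j, hence compresses to a product again. *)
Lemma scaling_outer_product h a b N M (e : M = (2 * N)%N) i j v :
  i != j -> is_product h a b ->
  Ystarpow Ys e (pair_op h (leg e i ord_max) (leg e j ord0) (Ypow Y e (pure v))) =
  pure (fun k => if k == i then conj_site a ord_max (v k)
                 else if k == j then conj_site b ord0 (v k) else v k).
Proof.
move=> ij hE; rewrite (pair_site _ _ hE) ?leg_eq ?(negPf ij) //.
rewrite Ypow_pure_bprod !site_bprod Ystarpow_bprod; congr pure; apply/funext => k.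
case: eqP => [->|_]; first by rewrite (negPf ij) !comp_lfunE.
by case: eqP => _; rewrite ?YsK // !comp_lfunE.
Qed.

(** The first summand of the scale invariance map: what two neighbouring sites
    inherit from the term between their blocks. *)
Definition outerS (h : 'End(tpow V 2)) : 'End(tpow V 2) :=
  let e : 4%N = (2 * 2)%N := erefl in
  (Ystarpow Ys e \o
    (pair_op h (@Ordinal 4 1 isT) (@Ordinal 4 2 isT) \o Ypow Y e))%VF.

Lemma outerS_linear : linear outerS.
Proof.
by move=> c h h'; rewrite /outerS /= pair_op_linear sandwich_linear.
Qed.

(** [scaling_outer_product] computes both sides: the right one is its instance
    with two blocks, whose middle legs are the factors 1 and 2. *)
Lemma scaling_outer h N M (e : M = (2 * N)%N) i j : i != j ->
  (Ystarpow Ys e \o (pair_op h (leg e i ord_max) (leg e j ord0) \o Ypow Y e))%VF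
  = pair_op (outerS h) i j.
Proof.
move=> ij; move: h; apply: eq_on_products => [c h h'|c h h'|h a b hE].
- by rewrite pair_op_linear sandwich_linear.
- by rewrite outerS_linear pair_op_linear.
apply/lfunP/eq_on_pure => v /=; rewrite !comp_lfunE (scaling_outer_product _ _ ij hE).
rewrite (@pair_pure _ _ _ (conj_site a ord_max) (conj_site b ord0)) //= => x.
rewrite !comp_lfunE.
have -> : @Ordinal 4 1 isT = leg (erefl : 4%N = (2 * 2)%N) ord0 ord_max by exact/val_inj.
have -> : @Ordinal 4 2 isT = leg (erefl : 4%N = (2 * 2)%N) ord_max ord0 by exact/val_inj.
rewrite (scaling_outer_product _ _ _ hE) //; congr pure; apply/funext => k.
case: eqP => // k0; case: eqP => // k1.
by case: k k0 k1 => [[|[|//]]] lk k0 k1; [case: k0|case: k1]; apply/val_inj.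
Qed.

Lemma scaleS_linear : linear (scaleS Y Ys).
Proof.
move=> c h h'; rewrite /scaleS /= pair_op_linear !sandwich_linear.
suff site_lin : linear (fun g : 'End(V) => site_op g (ord0 : 'I_2)).
  by rewrite site_lin scalerDr addrACA.
move=> d g g'; apply/lfunP => F; rewrite add_lfunE scale_lfunE !lfunE /=.
by apply/ffunP => I; rewrite !ffunE add_lfunE scale_lfunE /bcoord linearP.
Qed.

(** The two legs of the site i carry the term inside the block i and the term
    between the blocks i and i + 1; on one site the latter would join the block
    to itself. *)
Lemma scaling_hamiltonian h N M (e : M = (2 * N)%N) : (2 <= N)%N ->
  (Ystarpow Ys e \o (hamiltonian h M \o Ypow Y e))%VF = hamiltonian (scaleS Y Ys h) N.
Proof.
move=> N2; rewrite /hamiltonian (big_leg _ e) /=.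
apply/lfunP => F; rewrite !comp_lfunE !sum_lfunE linear_sum.
apply: eq_bigr => i _; have iS := ordS_neq i N2.
rewrite add_lfunE linearD /= ordS_leg0 ordS_leg1 addrC.
have /lfunP/(_ F) := scaling_outer h e iS; rewrite !comp_lfunE => ->.
have /lfunP/(_ F) := scaling_inner h e i; rewrite !comp_lfunE => ->.
rewrite -add_lfunE; congr (_ F).
rewrite /scaleS -[(_ \o _)%VF in RHS]scale1r pair_op_linear scale1r.
by rewrite (pair_site0 _ iS).
Qed.

End Adjoint.
End Blocks.

(** * Coherent preimages in finite dimension *)

Section Tower.
Variables (K : fieldType) (E : vectType K) (f : 'End(E)).

Let iimg k : {vspace E} := iter k (fun U => f @: U)%VS fullv.

Lemma iter_image_stable : exists k, (f @: iimg k)%VS = iimg k.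
Proof.
have sub k : (iimg k.+1 <= iimg k)%VS.
  by elim: k => [|k IH]; [exact: subvf | exact: limgS].
have [//|nostab] := pselect (exists k, (f @: iimg k)%VS = iimg k).
have drop k : (\dim (iimg k) + k <= \dim {:E})%N.
  elim: k => [|k IH]; first by rewrite addn0.
  apply: leq_trans IH; rewrite addnS ltn_add2r ltn_neqAle.
  rewrite (dimv_leqif_eq (sub k)) dimvS // andbT.
  by apply/eqP => stab; apply: nostab; exists k.
by have := drop (\dim {:E}).+1; rewrite addnS ltnNge leq_addl.
Qed.

(** Preimages chosen one by one could lead to a vector without preimage; choosing
    them in the stationary image U avoids this, as f maps U onto itself. *)
Lemma coherent_preimages x :
  (forall k, exists y, iter k f y = x) ->
  exists xs : nat -> E, xs 0%N = x /\ forall k, f (xs k.+1) = xs k.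
Proof.
move=> xE; have [k stab] := iter_image_stable; set U := iimg k in stab.
have Ux : x \in U.
  have [y <-] := xE k; rewrite /U; elim: (k) => [|m IH]; first exact: memvf.
  exact: memv_img.
(* s is a section of f over U with values in U: composing with the projection
   on both sides makes the generic right inverse of g land in U. *)
pose g := (f \o projv U)%VF.
have gU : limg g = U by rewrite limg_comp limg_proj.
pose s := (projv U \o g^-1)%VF.
have sU y : s y \in U by rewrite comp_lfunE memv_proj.
have fs y : y \in U -> f (s y) = y.
  by move=> Uy; rewrite comp_lfunE -[LHS]comp_lfunE limg_lfunVK ?gU.
exists (fun m => iter m s x); split=> // m; rewrite /= fs //.
by case: m => [|m] //=.
Qed.

End Tower.

(** * Gluing forms on the direct limit *)

Section Limit.
Variables (C : numClosedFieldType) (V : vectType C) (dot : {dot V for conjC}).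
Variables (Y : 'Hom(V, tpow V 2)) (H : lmodType C) (dotH : {dot H for conjC}).
Variable j : forall m, {linear tpow V (2 ^ m) -> H}.
Hypothesis limH : direct_limit dot Y dotH j.

(** An isometry is injective because the inner product is nondegenerate. *)
Lemma limit_inj m : injective (j m).
Proof.
move=> F G FG; apply/eqP; rewrite -subr_eq0; apply/eqP.
apply: (tdot_nondegenerate (dot := dot)) => G'.
by rewrite -(direct_limit_isometry limH) linearB FG subrr linear0l.
Qed.

Lemma limit_reach (x : H) : exists m, forall p, (m <= p)%N -> exists F, j p F = x.
Proof.
have [m [F <-]] := direct_limit_exhaust limH x.
exists m => p /subnK <-; elim: (p - m)%N => [|d [G <-]]; first by exists F.
by exists (embed Y _ G); exact: direct_limit_compat limH _ _.
Qed.

Variables (n : nat) (T : forall m, tpow V (2 ^ m) -> tpow V (2 ^ m) -> C).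
Hypothesis Tl : forall m a F F' G, T (a *: F + F') G = a * @T m F G + T F' G.
Hypothesis Tr : forall m a F G G', T F (a *: G + G') = a^* * @T m F G + T F G'.
Hypothesis T_embed : forall m F G, (n <= m)%N ->
  T (embed Y m F) (embed Y m G) = T F G.

Lemma glue_levels m p (F G : tpow V (2 ^ m)) (F' G' : tpow V (2 ^ p)) :
  (n <= m <= p)%N -> j m F = j p F' -> j m G = j p G' -> T F G = T F' G'.
Proof.
case/andP=> nm /subnK E; move: (p - m)%N E => d E.
elim: d m F G nm E => [|d IH] m F G nm E.
  by subst p => /limit_inj -> /limit_inj ->.
rewrite -(direct_limit_compat limH F) -(direct_limit_compat limH G) -(T_embed F G) //.
by apply: IH; [exact: leqW | rewrite addnS].
Qed.

(** The value at (x, y) is read off at any common level, [glue_levels] making it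
    independent of the level; (semi)linearity is checked at a level that reaches
    all the vectors involved. *)
Lemma glue_form :
  exists Q : sesquilinear_form H,
    forall m (F G : tpow V (2 ^ m)), (n <= m)%N -> Q (j m F) (j m G) = T F G.
Proof.
have /choice [q qE] : forall xy : H * H, exists c : C,
    forall m (F G : tpow V (2 ^ m)), (n <= m)%N ->
      j m F = xy.1 -> j m G = xy.2 -> T F G = c.
  case=> x y /=; have [mx xE] := limit_reach x; have [my yE] := limit_reach y.
  pose p := maxn n (maxn mx my).
  have [|F FE] := xE p; first by rewrite /p !leq_max leqnn orbT.
  have [|G GE] := yE p; first by rewrite /p !leq_max leqnn !orbT.
  exists (T F G) => m F' G' nm F'E G'E.
  have [mp|/ltnW pm] := leqP m p.
    by apply: glue_levels; rewrite ?nm ?FE ?GE.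
  symmetry; apply: glue_levels; rewrite ?FE ?GE ?pm //.
  by rewrite /p leq_max leqnn.
pose Q x y := q (x, y).
have QE m (F G : tpow V (2 ^ m)) : (n <= m)%N -> Q (j m F) (j m G) = T F G.
  by move=> nm; rewrite (qE (j m F, j m G) m F G).
have common x y z : exists m, [/\ (n <= m)%N, exists F, j m F = x,
    exists F, j m F = y & exists F, j m F = z].
  have [mx xE] := limit_reach x; have [my yE] := limit_reach y.
  have [mz zE] := limit_reach z.
  exists (maxn n (maxn mx (maxn my mz))); split; last 1 first.
  - by apply: zE; rewrite !leq_max leqnn !orbT.
  - by rewrite !leq_max leqnn.
  - by apply: xE; rewrite !leq_max leqnn !orbT.
  by apply: yE; rewrite !leq_max leqnn !orbT.
have Qbil : bilinear_for (GRing.Scale.Law.clone _ _ *%R _)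
    (GRing.Scale.Law.clone _ _ (conjC \; *%R) _) Q.
  split=> [z|z] a x y; have [m [nm [F <-] [G <-] [F' <-]]] := common x y z.
    by rewrite -linearP !QE // Tl.
  by rewrite -linearP !QE // Tr.
pose bQ : sesquilinear_form H := HB.pack Q (bilinear_isBilinear.Build _ _ _ _ _ _ Q Qbil).
by exists bQ.
Qed.

End Limit.

(** * The scaling identity and the extended form *)

Lemma scaling_form (C : numClosedFieldType) (V : vectType C)
    (dot : {dot V for conjC}) (Y : 'Hom(V, tpow V 2)) (Ys : 'Hom(tpow V 2, V)) :
  (forall v w, tdot dot (Y v) w = dot v (Ys w)) -> (Ys \o Y)%VF = \1%VF ->
  forall h n, (1 <= n)%N -> forall xi eta : tpow V (2 ^ n),
  tdot dot (hamiltonian h (2 ^ n.+1) (embed Y n xi)) (embed Y n eta)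
  = tdot dot (hamiltonian (scaleS Y Ys h) (2 ^ n) xi) eta.
Proof.
move=> adjY isoY h n n1 xi eta; rewrite (tdot_Ypow adjY).
have N2 : (2 <= 2 ^ n)%N by rewrite -{1}(expn1 2) leq_exp2l.
have /lfunP/(_ xi) := scaling_hamiltonian isoY h (expnS 2 n) N2.
by rewrite !comp_lfunE => ->.
Qed.

Lemma coherent_scaleS (C : numClosedFieldType) (V : vectType C)
    (Y : 'Hom(V, tpow V 2)) (Ys : 'Hom(tpow V 2, V)) (h : 'End(tpow V 2)) :
  (forall k, exists g, iter k (scaleS Y Ys) g = h) ->
  exists hs, hs 0%N = h /\ forall k, scaleS Y Ys (hs k.+1) = hs k.
Proof.
pose lS : {linear 'End(tpow V 2) -> 'End(tpow V 2)} := HB.pack (scaleS Y Ys)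
  (GRing.isLinear.Build _ _ _ _ _ (@scaleS_linear _ _ Y Ys)).
have lSE : linfun lS =1 scaleS Y Ys by move=> g; rewrite lfunE.
move=> h_desc; have [|hs [hs0 hsS]] := @coherent_preimages _ _ (linfun lS) h.
  by move=> k; have [g <-] := h_desc k; exists g; apply: eq_iter.
by exists hs; split=> // k; rewrite -lSE hsS.
Qed.

(** At level m the interaction is h_(m - n), so that going up one level is undone
    by one application of S. *)
Lemma extended_form (C : numClosedFieldType) (V : vectType C)
    (dot : {dot V for conjC}) (Y : 'Hom(V, tpow V 2)) (Ys : 'Hom(tpow V 2, V))
    (H : lmodType C) (dotH : {dot H for conjC})
    (j : forall m, {linear tpow V (2 ^ m) -> H}) n (hs : nat -> 'End(tpow V 2)) :
  (forall v w, tdot dot (Y v) w = dot v (Ys w)) -> (Ys \o Y)%VF = \1%VF ->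
  direct_limit dot Y dotH j -> (1 <= n)%N ->
  (forall k, scaleS Y Ys (hs k.+1) = hs k) ->
  exists Q : sesquilinear_form H, forall m (F G : tpow V (2 ^ m)), (n <= m)%N ->
    Q (j m F) (j m G) = tdot dot (hamiltonian (hs (m - n)%N) (2 ^ m) F) G.
Proof.
move=> adjY isoY limH n1 hsS.
apply: (glue_form limH (T := fun m F G =>
  tdot dot (hamiltonian (hs (m - n)%N) (2 ^ m) F) G)).
- by move=> m a F F' G; rewrite linearP tdotPl.
- by move=> m a F G G'; rewrite tdotPr.
move=> m F G nm; rewrite (scaling_form adjY isoY) ?(leq_trans n1) //.
by rewrite subSn // hsS.
Qed.

Theorem theorem4p2 (R : realType) (V : vectType R[i])
    (dot : {dot V for conjC})
    (Y : 'Hom(V, tpow V 2)) (Ys : 'Hom(tpow V 2, V))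
    (adjY : forall (v : V) (w : tpow V 2), tdot dot (Y v) w = dot v (Ys w))
    (isoY : (Ys \o Y)%VF = \1%VF)
    (h : 'End(tpow V 2)) (n : nat) (n_ge1 : (1 <= n)%N) :
  (forall xi eta : tpow V (2 ^ n),
     tdot dot (hamiltonian h (2 ^ n.+1) (embed Y n xi)) (embed Y n eta)
     = tdot dot (hamiltonian (scaleS Y Ys h) (2 ^ n) xi) eta)
  /\
  (forall (H : lmodType R[i]) (dotH : {dot H for conjC})
          (j : forall m, {linear tpow V (2 ^ m) -> H}),
     direct_limit dot Y dotH j ->
     (forall k : nat, exists g : 'End(tpow V 2), iter k (scaleS Y Ys) g = h) ->
     exists (hs : nat -> 'End(tpow V 2)) (Q : sesquilinear_form H),
       [/\ hs 0%N = h,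
           forall k, scaleS Y Ys (hs k.+1) = hs k,
           forall xi eta : tpow V (2 ^ n),
             Q (j n xi) (j n eta) = tdot dot (hamiltonian h (2 ^ n) xi) eta
         & forall k (xi eta : tpow V (2 ^ (n + k))),
             Q (j (n + k)%N xi) (j (n + k)%N eta)
             = tdot dot (hamiltonian (hs k) (2 ^ (n + k)) xi) eta]).
Proof.
split=> [xi eta|H dotH j limH h_desc]; first exact: scaling_form.
have [hs [hs0 hsS]] := coherent_scaleS h_desc.
have [Q QE] := extended_form adjY isoY limH n_ge1 hsS.
by exists hs, Q; split=> // [xi eta|k xi eta]; rewrite QE ?leq_addr ?subnn ?addKn ?hs0.
Qed.
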